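(* Let $\phi:(Q,\alpha)\to(Q',\alpha')$ be a virtual quandle homomorphism. Then a virtual derived quandle $(\mathcal{A}_\phi,\Gamma,\partial)$ of $\phi$ exists, and it is unique up to isomorphism.
   Context: A quandle is a non-empty set $Q$ with a binary operation $*$ such that (Q1) $q*q=q$ for all $q$; (Q2) for all $q_1,q_2\in Q$ there is a unique $q\in Q$ with $q_2=q*q_1$; (Q3) $(q_1*q_2)*q_3=(q_1*q_3)*(q_2*q_3)$ for all $q_1,q_2,q_3$. A virtual quandle $(Q,\alpha)$ is a quandle $Q$ together with a quandle automorphism $\alpha$ of $Q$. A virtual quandle homomorphism $f:(Q,\alpha)\to(Q',\alpha')$ is a map with $f(q_1*q_2)=f(q_1)*f(q_2)$ for all $q_1,q_2$ and $\alpha'\circ f=f\circ\alpha$. $\operatorname{Aut}(A,\gamma)$ denotes the group of automorphisms of the virtual quandle $(A,\gamma)$. The associated group $\operatorname{As}(Q)$ is the group generated by $\{e_q\mid q\in Q\}$ modulo $e_{q_1*q_2}=e_{q_2}e_{q_1}e_{q_2}^{-1}$; $\alpha$ induces an automorphism, also denoted $\alpha$, of $\operatorname{As}(Q)$ by $\alpha(e_q)=e_{\alpha(q)}$. A virtual quandle homomorphism $\phi$ induces a group homomorphism $\phi:\operatorname{As}(Q)\to\operatorname{As}(Q')$, $\phi(e_q)=e_{\phi(q)}$. A virtual quandle $(A,\gamma)$ is a $(Q,\alpha)$-quandle if it is equipped with a group homomorphism $\varphi:\operatorname{As}(Q)\to\operatorname{Aut}(A,\gamma)$ such that $S_\gamma\circ\varphi=\varphi\circ\alpha$,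 where $S_\gamma(f)=\gamma f\gamma^{-1}$; write $g\cdot a=\varphi(g)(a)$. A $(Q,\alpha)$-homomorphism between $(Q,\alpha)$-quandles is a virtual quandle homomorphism $f$ with $f(g\cdot a)=g\cdot f(a)$ for all $g\in\operatorname{As}(Q)$ and all $a$. Given a virtual quandle homomorphism $\phi:(Q,\alpha)\to(Q',\alpha')$ and a $(Q',\alpha')$-quandle $(A,\gamma)$, a (virtual) derivation $\partial:(Q,\alpha)\to(A,\gamma)$ is a map $\partial:Q\to A$ with $\partial(q_1*q_2)=\partial(q_1)*\big(\phi(e_{q_1})\cdot\partial(q_2)\big)$ for all $q_1,q_2\in Q$ and $\gamma\circ\partial=\partial\circ\alpha$. A virtual derived quandle of $\phi$ consists of a $(Q',\alpha')$-quandle $(\mathcal{A}_\phi,\Gamma)$ and a derivation $\partial:(Q,\alpha)\to(\mathcal{A}_\phi,\Gamma)$ such that for every $(Q',\alpha')$-quandle $(A,\gamma)$ and every derivation $\partial':(Q,\alpha)\to(A,\gamma)$ there is a unique $(Q',\alpha')$-homomorphism $\lambda:(\mathcal{A}_\phi,\Gamma)\to(A,\gamma)$ with $\lambda\circ\partial=\partial'$. An isomorphism between two virtual derived quandles of $\phi$ is a bijective $(Q',\alpha')$-homomorphism compatible with the two derivations from $(Q,\alpha)$. *)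

(* Defs.v *)
From HB Require Import structures.
From mathcomp Require Import all_boot.
From mathcomp Require Import boolp.

Set Implicit Arguments.
Unset Strict Implicit.
Unset Printing Implicit Defensive.

Declare Scope quandle_scope.
Delimit Scope quandle_scope with qdl.

HB.mixin Record isQuandle (Q : Type) := {
  qop : Q -> Q -> Q;
  quandle_inhabited : inhabited Q;
  qopxx : forall q : Q, qop q q = q;
  qop_div : forall q1 q2 : Q, exists! q : Q, q2 = qop q q1;
  qopD : forall q1 q2 q3 : Q,
    qop (qop q1 q2) q3 = qop (qop q1 q3) (qop q2 q3)
}.

#[short(type="quandleType")]
HB.structure Definition Quandle := {Q of isQuandle Q}.

Bind Scope quandle_scope with Quandle.sort.

Notation "x * y" := (qop x y) : quandle_scope.

Definition quandle_hom (Q Q' : quandleType) (f : Q -> Q') : Prop :=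
  forall q1 q2 : Q, f (q1 * q2)%qdl = (f q1 * f q2)%qdl.

HB.mixin Record Quandle_isVirtual Q of Quandle Q := {
  vaut : Q -> Q;
  vaut_hom : quandle_hom vaut;
  vaut_bij : bijective vaut
}.

#[short(type="vquandleType")]
HB.structure Definition VQuandle := {Q of Quandle_isVirtual Q & Quandle Q}.

Bind Scope quandle_scope with VQuandle.sort.

Definition vquandle_hom (Q Q' : vquandleType) (f : Q -> Q') : Prop :=
  quandle_hom f /\ forall q : Q, vaut (f q) = f (vaut q).

(* The automorphism group Aut(A, gamma), with composition as product:         *)
(* (f * g) a = f (g a).                                                       *)
Section VirtualAutomorphisms.
Variable A : vquandleType.

Record vAut := VAut {
  vAut_fun :> A -> A;
  vAut_hom : vquandle_hom vAut_fun;
  vAut_bij : bijective vAut_fun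
}.

Lemma vAut_eqP (f g : vAut) : (forall a : A, f a = g a) -> f = g.
Proof.
case: f g => [f fh fb] [g gh gb] /= /funext fg.
by case: _ / fg in gh gb *; congr VAut; exact: Prop_irrelevance.
Qed.

HB.instance Definition _ := gen_eqMixin vAut.
HB.instance Definition _ := gen_choiceMixin vAut.

Fact vAut_one_hom : vquandle_hom (@idfun A). Proof. by []. Qed.
Fact vAut_one_bij : bijective (@idfun A). Proof. by exists idfun. Qed.
Definition vAut_one := VAut vAut_one_hom vAut_one_bij.

Fact vAut_mul_hom (f g : vAut) : vquandle_hom (f \o g).
Proof.
have [[fM fC] [gM gC]] := (vAut_hom f, vAut_hom g).
by split=> [a b|a] /=; rewrite ?gM ?fM // fC gC.
Qed.
Fact vAut_mul_bij (f g : vAut) : bijective (f \o g).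
Proof. by apply: bij_comp; exact: vAut_bij. Qed.
Definition vAut_mul (f g : vAut) := VAut (vAut_mul_hom f g) (vAut_mul_bij f g).

Fact vAut_cancel (f : vAut) : exists g : A -> A, cancel f g /\ cancel g f.
Proof. by have [g fK gK] := vAut_bij f; exists g. Qed.
Definition vAut_inv_fun (f : vAut) : A -> A := projT1 (cid (vAut_cancel f)).
Lemma vAut_funK (f : vAut) : cancel f (vAut_inv_fun f).
Proof. by rewrite /vAut_inv_fun; case: cid => g []. Qed.
Lemma vAut_inv_funK (f : vAut) : cancel (vAut_inv_fun f) f.
Proof. by rewrite /vAut_inv_fun; case: cid => g []. Qed.
Fact vAut_inv_hom (f : vAut) : vquandle_hom (vAut_inv_fun f).
Proof.
have [fM fC] := vAut_hom f; have fK := vAut_funK f; have Kf := vAut_inv_funK f.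
by split=> [a b|a]; apply: (can_inj fK); rewrite ?fM -?fC !Kf.
Qed.
Fact vAut_inv_bij (f : vAut) : bijective (vAut_inv_fun f).
Proof. by exists f; [exact: vAut_inv_funK | exact: vAut_funK]. Qed.
Definition vAut_inv (f : vAut) := VAut (vAut_inv_hom f) (vAut_inv_bij f).

Fact vAut_mulA : associative vAut_mul.
Proof. by move=> f g h; exact: vAut_eqP. Qed.
Fact vAut_mul1 : left_id vAut_one vAut_mul.
Proof. by move=> f; exact: vAut_eqP. Qed.
Fact vAut_mulr1 : right_id vAut_one vAut_mul.
Proof. by move=> f; exact: vAut_eqP. Qed.
Fact vAut_mulV : left_inverse vAut_one vAut_inv vAut_mul.
Proof. by move=> f; apply: vAut_eqP => a /=; exact: vAut_funK. Qed.
Fact vAut_mulrV : right_inverse vAut_one vAut_inv vAut_mul.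
Proof. by move=> f; apply: vAut_eqP => a /=; exact: vAut_inv_funK. Qed.

HB.instance Definition _ := isGroup.Build vAut
  vAut_mulA vAut_mul1 vAut_mulr1 vAut_mulV vAut_mulrV.

Fact vAut_vaut_hom : vquandle_hom (@vaut A).
Proof. by split=> //; exact: vaut_hom. Qed.
Definition vAut_vaut : vAut := VAut vAut_vaut_hom vaut_bij.

(* S_gamma f = gamma f gamma^-1. Elements of Aut(A, gamma) commute with gamma *)
(* by definition, so this is in fact the identity of Aut(A, gamma).           *)
Definition vAut_conj (f : vAut) : vAut := (vAut_vaut * f * vAut_vaut^-1)%g.

End VirtualAutomorphisms.

(* As(Q) is the quotient of the formal group words on Q by the least group    *)
(* congruence containing the defining relations.                              *)
Section AssociatedGroup.
Variable Q : quandleType.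

Inductive As_word : Type :=
  | Word_one
  | Word_gen of Q
  | Word_inv of As_word
  | Word_mul of As_word & As_word.

Inductive As_eq : As_word -> As_word -> Prop :=
  | As_eq_refl u : As_eq u u
  | As_eq_sym u v : As_eq u v -> As_eq v u
  | As_eq_trans u v w : As_eq u v -> As_eq v w -> As_eq u w
  | As_eq_inv u v : As_eq u v -> As_eq (Word_inv u) (Word_inv v)
  | As_eq_mul u u' v v' :
      As_eq u u' -> As_eq v v' -> As_eq (Word_mul u v) (Word_mul u' v')
  | As_eq_mulA u v w :
      As_eq (Word_mul u (Word_mul v w)) (Word_mul (Word_mul u v) w)
  | As_eq_mul1 u : As_eq (Word_mul Word_one u) u
  | As_eq_mulr1 u : As_eq (Word_mul u Word_one) u
  | As_eq_mulV u : As_eq (Word_mul (Word_inv u) u) Word_one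
  | As_eq_mulrV u : As_eq (Word_mul u (Word_inv u)) Word_one
  | As_eq_rel q1 q2 :
      As_eq (Word_gen (q1 * q2)%qdl)
            (Word_mul (Word_mul (Word_gen q2) (Word_gen q1))
                      (Word_inv (Word_gen q2))).

HB.instance Definition _ := gen_eqMixin As_word.
HB.instance Definition _ := gen_choiceMixin As_word.

Definition As_rel : rel As_word := fun u v => `[< As_eq u v >].

Fact As_rel_equiv : equiv_class_of As_rel.
Proof.
split=> [u|u v|v u w].
- by apply/asboolP; exact: As_eq_refl.
- by apply/asboolP/asboolP; exact: As_eq_sym.
- by move=> /asboolP uv /asboolP vw; apply/asboolP; exact: As_eq_trans uv vw.
Qed.

Canonical As_equiv := EquivRelPack As_rel_equiv.

Local Open Scope quotient_scope.

Definition As : Type := {eq_quot As_equiv}.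
HB.instance Definition _ := Choice.on As.
HB.instance Definition _ := Quotient.on As.

Lemma As_piP (u v : As_word) : As_eq u v <-> \pi_As u = \pi_As v.
Proof.
split; first by move=> uv; apply/eqmodP; apply/asboolP.
by move/eqmodP/asboolP.
Qed.

Lemma As_eq_repr (u : As_word) : As_eq (repr (\pi_As u)) u.
Proof. by apply/As_piP; rewrite reprK. Qed.

Definition As_one : As := \pi_As Word_one.
Definition As_inv (x : As) : As := \pi_As (Word_inv (repr x)).
Definition As_mul (x y : As) : As := \pi_As (Word_mul (repr x) (repr y)).
Definition As_gen (q : Q) : As := \pi_As (Word_gen q).

Lemma As_inv_pi u : As_inv (\pi_As u) = \pi_As (Word_inv u).
Proof. by apply/As_piP; apply: As_eq_inv; exact: As_eq_repr. Qed.
Lemma As_mul_pi u v : As_mul (\pi_As u) (\pi_As v) = \pi_As (Word_mul u v).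
Proof. by apply/As_piP; apply: As_eq_mul; exact: As_eq_repr. Qed.

Fact As_mulA : associative As_mul.
Proof.
elim/quotW=> u; elim/quotW=> v; elim/quotW=> w.
rewrite (As_mul_pi v w) (As_mul_pi u v) (As_mul_pi u) (As_mul_pi _ w).
by apply/As_piP; exact: As_eq_mulA.
Qed.
Fact As_mul1 : left_id As_one As_mul.
Proof.
by elim/quotW=> u; rewrite As_mul_pi; apply/As_piP; exact: As_eq_mul1.
Qed.
Fact As_mulr1 : right_id As_one As_mul.
Proof.
by elim/quotW=> u; rewrite As_mul_pi; apply/As_piP; exact: As_eq_mulr1.
Qed.
Fact As_mulV : left_inverse As_one As_inv As_mul.
Proof.
elim/quotW=> u; rewrite As_inv_pi As_mul_pi.
by apply/As_piP; exact: As_eq_mulV.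
Qed.
Fact As_mulrV : right_inverse As_one As_inv As_mul.
Proof.
elim/quotW=> u; rewrite As_inv_pi As_mul_pi.
by apply/As_piP; exact: As_eq_mulrV.
Qed.

HB.instance Definition _ := isGroup.Build As
  As_mulA As_mul1 As_mulr1 As_mulV As_mulrV.

Lemma As_gen_op (q1 q2 : Q) :
  As_gen (q1 * q2)%qdl = (As_gen q2 * As_gen q1 * (As_gen q2)^-1)%g.
Proof.
rewrite -[RHS]/(As_mul (As_mul (As_gen q2) (As_gen q1)) (As_inv (As_gen q2))).
rewrite /As_gen (As_inv_pi (Word_gen q2)) (As_mul_pi (Word_gen q2)).
by rewrite As_mul_pi; apply/As_piP; exact: As_eq_rel.
Qed.

End AssociatedGroup.

(* The map induced by f on associated groups; it is only meaningful when f is *)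
(* a quandle homomorphism, in which case it is the group morphism sending     *)
(* As_gen q to As_gen (f q).                                                  *)
Section AssociatedGroupMap.
Variables Q Q' : quandleType.
Variable f : Q -> Q'.

Fixpoint word_map (u : As_word Q) : As_word Q' :=
  match u with
  | Word_one => Word_one Q'
  | Word_gen q => Word_gen (f q)
  | Word_inv v => Word_inv (word_map v)
  | Word_mul v w => Word_mul (word_map v) (word_map w)
  end.

Definition As_map (x : As Q) : As Q' := (\pi_(As Q') (word_map (repr x)))%qT.

Hypothesis f_hom : quandle_hom f.

Lemma word_map_eq (u v : As_word Q) :
  As_eq u v -> As_eq (word_map u) (word_map v).
Proof.
elim=> /= {u v}.
- by move=> u; exact: As_eq_refl.
- by move=> u v _; exact: As_eq_sym.
- by move=> u v w _ uv _; exact: As_eq_trans uv.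
- by move=> u v _; exact: As_eq_inv.
- by move=> u u' v v' _ uu' _; exact: As_eq_mul.
- by move=> u v w; exact: As_eq_mulA.
- by move=> u; exact: As_eq_mul1.
- by move=> u; exact: As_eq_mulr1.
- by move=> u; exact: As_eq_mulV.
- by move=> u; exact: As_eq_mulrV.
- by move=> q1 q2; rewrite f_hom; exact: As_eq_rel.
Qed.

Lemma As_map_pi (u : As_word Q) :
  As_map (\pi_(As Q) u)%qT = (\pi_(As Q') (word_map u))%qT.
Proof. by apply/As_piP; apply: word_map_eq; exact: As_eq_repr. Qed.

Lemma As_map_gen (q : Q) : As_map (As_gen q) = As_gen (f q).
Proof. exact: As_map_pi. Qed.

Lemma As_mapM : {morph As_map : x y / (x * y)%g >-> (x * y)%g}.
Proof.
elim/quotW=> u; elim/quotW=> v.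
apply: (etrans (congr1 As_map (As_mul_pi u v))).
by rewrite As_map_pi (As_map_pi u) (As_map_pi v) -As_mul_pi.
Qed.

End AssociatedGroupMap.

(* (Q, alpha)-quandles, with alpha = vaut; xaction_conj is the equality       *)
(* S_gamma \o xaction = xaction \o alpha.                                     *)
Record xquandle (Q : vquandleType) := XQuandle {
  xquandle_sort :> vquandleType;
  xaction : UMagmaMorphism.type (As Q) (vAut xquandle_sort);
  xaction_conj :
    forall g : As Q, vAut_conj (xaction g) = xaction (As_map vaut g)
}.

Definition xact (Q : vquandleType) (A : xquandle Q) (g : As Q) (a : A) : A :=
  (xaction A g : vAut A) a.

Definition xquandle_hom (Q : vquandleType) (A B : xquandle Q) (f : A -> B) :
    Prop :=
  vquandle_hom f /\ forall (g : As Q) (a : A), f (xact g a) = xact g (f a).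

Definition derivation (Q Q' : vquandleType) (phi : Q -> Q') (A : xquandle Q')
    (d : Q -> A) : Prop :=
  (forall q1 q2 : Q,
     d (q1 * q2)%qdl = (d q1 * xact (As_map phi (As_gen q1)) (d q2))%qdl)
  /\ forall q : Q, vaut (d q) = d (vaut q).

Definition virtual_derived (Q Q' : vquandleType) (phi : Q -> Q')
    (A : xquandle Q') (d : Q -> A) : Prop :=
  derivation phi d /\
  forall (B : xquandle Q') (d' : Q -> B), derivation phi d' ->
    exists! l : A -> B, xquandle_hom l /\ forall q : Q, l (d q) = d' q.

Definition virtual_derived_iso (Q Q' : vquandleType) (A1 A2 : xquandle Q')
    (d1 : Q -> A1) (d2 : Q -> A2) (f : A1 -> A2) : Prop :=
  [/\ xquandle_hom f, bijective f & forall q : Q, f (d1 q) = d2 q].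

(* Main.v *)
(* The derived quandle is the quotient of the algebra of formal terms over Q, in
   the operations of a (Q', alpha')-quandle, by the identities that hold under
   every derivation into every (Q', alpha')-quandle. Evaluations are well
   defined on this quotient and jointly separate its points, so every equational
   axiom is inherited from the targets. *)

From HB Require Import structures.
From mathcomp Require Import all_boot.
From mathcomp Require Import boolp.
Require Import Defs.

Set Implicit Arguments.
Unset Strict Implicit.
Unset Printing Implicit Defensive.

(** * Division, inverses and actions as operations satisfying identities *)

Section RightDivision.
Variable Q : quandleType.

(** Naming the unique solution turns (Q2) into identities between operations, which a quotient of
    terms can inherit. *)
Definition qdiv (q2 q1 : Q) : Q := projT1 (cid (qop_div q1 q2)).

Lemma qdivK (q1 q2 : Q) : (qdiv q2 q1 * q1)%qdl = q2.
Proof. by rewrite /qdiv; case: cid => q [] /= <-. Qed.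

Lemma qopI (q : Q) : injective (fun p : Q => (p * q)%qdl).
Proof.
move=> p1 p2 /= eqp; have [p [_ p_unique]] := qop_div q (p1 * q)%qdl.
by rewrite -(p_unique p1) // -(p_unique p2).
Qed.

End RightDivision.

(** Right multiplication by [f q1] is injective and sends both sides to [f q2]. *)
Lemma quandle_hom_div (Q Q' : quandleType) (f : Q -> Q') : quandle_hom f ->
  forall q2 q1 : Q, f (qdiv q2 q1) = qdiv (f q2) (f q1).
Proof. by move=> fM q2 q1; apply: (@qopI _ (f q1)); rewrite /= -fM !qdivK. Qed.

Section VirtualInverse.
Variable Q : vquandleType.

Definition vautV : Q -> Q := vAut_inv_fun (vAut_vaut Q).

Lemma vautK : cancel (@vaut Q) vautV.
Proof. exact: (vAut_funK (vAut_vaut Q)). Qed.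

Lemma vautVK : cancel vautV (@vaut Q).
Proof. exact: (vAut_inv_funK (vAut_vaut Q)). Qed.

Lemma vAut_conjE (f : vAut Q) : vAut_conj f = f.
Proof.
have [_ fC] := vAut_hom f.
by apply: vAut_eqP => q; rewrite [LHS]/= fC vautVK.
Qed.

End VirtualInverse.

Lemma vquandle_homV (Q Q' : vquandleType) (f : Q -> Q') : vquandle_hom f ->
  forall q : Q, f (vautV q) = vautV (f q).
Proof. by move=> [_ fC] q; apply: (can_inj (@vautK _)); rewrite fC !vautVK. Qed.

Section Action.
Variables (Q : vquandleType) (A : xquandle Q).

Lemma xact_hom (g : As Q) : vquandle_hom (@xact Q A g).
Proof. exact: vAut_hom. Qed.

Lemma xact1 (a : A) : xact 1%g a = a.
Proof. by rewrite /xact gmulf1. Qed.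

Lemma xactM (g h : As Q) (a : A) : xact (g * h)%g a = xact g (xact h a).
Proof. by rewrite /xact gmulfM. Qed.

(** Conjugation by [vaut] is trivial on automorphisms that commute with [vaut], so the compatibility
    condition becomes a plain identity of actions. *)
Lemma xact_vaut (g : As Q) (a : A) : xact (As_map vaut g) a = xact g a.
Proof. by rewrite /xact -xaction_conj vAut_conjE. Qed.

End Action.

(** * Formal terms and the quotient by universally valid identities *)

Section DerivedQuandle.
Variables (Q Q' : vquandleType) (phi : Q -> Q').

(** Division and the inverse of [vaut] are constructors so that the witnesses for (Q2) and for
    bijectivity are themselves terms. *)
Inductive derived_term : Type :=
  | Term_gen of Q
  | Term_op of derived_term & derived_term
  | Term_div of derived_term & derived_term
  | Term_vaut of derived_term
  | Term_vautV of derived_term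
  | Term_act of As Q' & derived_term.

HB.instance Definition _ := gen_eqMixin derived_term.
HB.instance Definition _ := gen_choiceMixin derived_term.

Fixpoint term_eval (B : xquandle Q') (d : Q -> B) (t : derived_term) : B :=
  match t with
  | Term_gen q => d q
  | Term_op t1 t2 => (term_eval d t1 * term_eval d t2)%qdl
  | Term_div t1 t2 => qdiv (term_eval d t1) (term_eval d t2)
  | Term_vaut t1 => vaut (term_eval d t1)
  | Term_vautV t1 => vautV (term_eval d t1)
  | Term_act g t1 => xact g (term_eval d t1)
  end.

(** The quantification over all targets stays inside a proposition, so the quotient is no larger
    than the type of terms and can itself serve as a target. *)
Definition derived_rel : rel derived_term := fun t u =>
  `[< forall (B : xquandle Q') (d : Q -> B), derivation phi d ->
      term_eval d t = term_eval d u >].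

Fact derived_rel_equiv : equiv_class_of derived_rel.
Proof.
split=> [t|t u|t u v]; first by apply/asboolP.
  by apply/asboolP/asboolP => eq_tu B d dd; rewrite eq_tu.
move=> /asboolP eq_ut /asboolP eq_tv; apply/asboolP => B d dd.
by rewrite eq_ut ?eq_tv.
Qed.

Canonical derived_equiv := EquivRelPack derived_rel_equiv.

Local Open Scope quotient_scope.

Definition derived : Type := {eq_quot derived_equiv}.
HB.instance Definition _ := Choice.on derived.
HB.instance Definition _ := Quotient.on derived.

Definition derived_eval (B : xquandle Q') (d : Q -> B) (x : derived) : B :=
  term_eval d (repr x).

(** The chosen representative of the class of [t] is related to [t], which means that every
    derivation gives the two the same value. *)
Lemma derived_eval_pi (B : xquandle Q') (d : Q -> B) (t : derived_term) :
  derivation phi d -> derived_eval d (\pi_derived t) = term_eval d t.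
Proof.
move=> dd; have /eqmodP/asboolP := reprK (\pi_derived t).
exact.
Qed.

Lemma derived_sep (x y : derived) :
  (forall (B : xquandle Q') (d : Q -> B), derivation phi d ->
     derived_eval d x = derived_eval d y) -> x = y.
Proof.
move=> eq_xy; rewrite -[x]reprK -[y]reprK.
by apply/eqmodP/asboolP.
Qed.

Definition derived_gen (q : Q) : derived := \pi_derived (Term_gen q).
Definition derived_op (x y : derived) : derived :=
  \pi_derived (Term_op (repr x) (repr y)).
Definition derived_div (x y : derived) : derived :=
  \pi_derived (Term_div (repr x) (repr y)).
Definition derived_vaut (x : derived) : derived :=
  \pi_derived (Term_vaut (repr x)).
Definition derived_vautV (x : derived) : derived :=
  \pi_derived (Term_vautV (repr x)).
Definition derived_act (g : As Q') (x : derived) : derived :=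
  \pi_derived (Term_act g (repr x)).

(** * Evaluation respects the operations of the quotient *)

Section Evaluation.
Variables (B : xquandle Q') (d : Q -> B).
Hypothesis dd : derivation phi d.

Lemma derived_eval_gen (q : Q) : derived_eval d (derived_gen q) = d q.
Proof. exact: derived_eval_pi. Qed.

Lemma derived_eval_op (x y : derived) :
  derived_eval d (derived_op x y) = (derived_eval d x * derived_eval d y)%qdl.
Proof. exact: derived_eval_pi. Qed.

Lemma derived_eval_div (x y : derived) :
  derived_eval d (derived_div x y) = qdiv (derived_eval d x) (derived_eval d y).
Proof. exact: derived_eval_pi. Qed.

Lemma derived_eval_vaut (x : derived) :
  derived_eval d (derived_vaut x) = vaut (derived_eval d x).
Proof. exact: derived_eval_pi. Qed.

Lemma derived_eval_vautV (x : derived) :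
  derived_eval d (derived_vautV x) = vautV (derived_eval d x).
Proof. exact: derived_eval_pi. Qed.

Lemma derived_eval_act (g : As Q') (x : derived) :
  derived_eval d (derived_act g x) = xact g (derived_eval d x).
Proof. exact: derived_eval_pi. Qed.

Definition derived_evalE := (derived_eval_gen, derived_eval_op,
  derived_eval_div, derived_eval_vaut, derived_eval_vautV, derived_eval_act).

End Evaluation.

(** * Quandle, virtual and action structures on the quotient *)

Fact derived_inhabited : inhabited derived.
Proof. by have [q] := @quandle_inhabited Q; exists; exact: derived_gen. Qed.

Fact derived_opxx (x : derived) : derived_op x x = x.
Proof. by apply: derived_sep => B d dd; rewrite derived_evalE // qopxx. Qed.

Fact derived_op_div (x y : derived) :
  exists! z : derived, y = derived_op z x.
Proof.
exists (derived_div y x); split=> [|z ->]; apply: derived_sep => B d dd.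
  by rewrite !derived_evalE // qdivK.
(* Uniqueness: in each target, the quotient of [z * x] by [x] is [z], by cancelling the right
   factor. *)
by apply: (@qopI _ (derived_eval d x)); rewrite /= !derived_evalE // qdivK.
Qed.

Fact derived_opD (x y z : derived) : derived_op (derived_op x y) z =
  derived_op (derived_op x z) (derived_op y z).
Proof. by apply: derived_sep => B d dd; rewrite !derived_evalE // qopD. Qed.

HB.instance Definition _ := isQuandle.Build derived
  derived_inhabited derived_opxx derived_op_div derived_opD.

Fact derived_vaut_hom : quandle_hom derived_vaut.
Proof.
move=> x y; apply: derived_sep => B d dd.
by rewrite !derived_evalE // vaut_hom.
Qed.

Fact derived_vaut_bij : bijective derived_vaut.
Proof.
exists derived_vautV => x; apply: derived_sep => B d dd;
  by rewrite !derived_evalE // ?vautK ?vautVK.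
Qed.

HB.instance Definition _ := Quandle_isVirtual.Build derived
  derived_vaut_hom derived_vaut_bij.

Fact derived_act_hom (g : As Q') : vquandle_hom (derived_act g).
Proof.
split=> [x y|x]; apply: derived_sep => B d dd;
  have [gM gC] := @xact_hom _ B g; by rewrite !derived_evalE // ?gM ?gC.
Qed.

Fact derived_act1 (x : derived) : derived_act 1%g x = x.
Proof. by apply: derived_sep => B d dd; rewrite derived_evalE // xact1. Qed.

Fact derived_actM (g h : As Q') (x : derived) :
  derived_act (g * h)%g x = derived_act g (derived_act h x).
Proof. by apply: derived_sep => B d dd; rewrite !derived_evalE // xactM. Qed.

Fact derived_act_vaut (g : As Q') (x : derived) :
  derived_act (As_map vaut g) x = derived_act g x.
Proof. by apply: derived_sep => B d dd; rewrite !derived_evalE // xact_vaut. Qed.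

Fact derived_act_bij (g : As Q') : bijective (derived_act g).
Proof.
by exists (derived_act g^-1%g) => x;
  rewrite -derived_actM ?mulVg ?mulgV derived_act1.
Qed.

Definition derived_aut (g : As Q') : vAut derived :=
  VAut (derived_act_hom g) (derived_act_bij g).

Fact derived_aut_morphism : {morph derived_aut : g h / (g * h)%g >-> (g * h)%g}.
Proof. by move=> g h; apply: vAut_eqP => x; exact: derived_actM. Qed.

Fact derived_aut1 : derived_aut 1%g = 1%g.
Proof. by apply: vAut_eqP => x; exact: derived_act1. Qed.

HB.instance Definition _ :=
  isMultiplicative.Build (As Q') (vAut derived) derived_aut
    derived_aut_morphism.
HB.instance Definition _ :=
  Multiplicative_isUMagmaMorphism.Build (As Q') (vAut derived) derived_aut
    derived_aut1.

Fact derived_aut_conj (g : As Q') :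
  vAut_conj (derived_aut g) = derived_aut (As_map vaut g).
Proof.
by rewrite vAut_conjE; apply: vAut_eqP => x; rewrite /= derived_act_vaut.
Qed.

Definition derived_xquandle : xquandle Q' := XQuandle derived_aut_conj.

(** * The universal derivation *)

Lemma derived_gen_derivation :
  derivation phi (derived_gen : Q -> derived_xquandle).
Proof.
split=> [q1 q2|q]; apply: derived_sep => B d dd; have [dM dC] := dd;
  by rewrite !derived_evalE // ?dM ?dC.
Qed.

Lemma derived_eval_hom (B : xquandle Q') (d : Q -> B) : derivation phi d ->
  xquandle_hom (derived_eval d : derived_xquandle -> B).
Proof.
move=> dd; do ![split].
- exact: derived_eval_op.
- by move=> x; rewrite -derived_eval_vaut.
- exact: derived_eval_act.
Qed.

(** Induction on terms; division and the inverse of [vaut] are preserved because the other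
    operations determine them. *)
Lemma xquandle_hom_eval (A B : xquandle Q') (d : Q -> A) (f : A -> B) :
  xquandle_hom f ->
  forall t, f (term_eval d t) = term_eval (f \o d) t.
Proof.
move=> [fv fX]; have [fM fC] := fv.
elim=> //= [t <- u <-|t <- u <-|t <-|t <-|g t <-] //.
- exact: quandle_hom_div.
- exact: vquandle_homV.
Qed.

(** This says that the generators generate. Under [derived_eval d] both sides become
    [term_eval d t], since [derived_eval d] is a homomorphism taking the generators to the values of
    [d]. *)
Lemma term_eval_gen (t : derived_term) :
  term_eval (derived_gen : Q -> derived_xquandle) t = \pi_derived t.
Proof.
apply: derived_sep => B d dd; rewrite (derived_eval_pi _ dd).
rewrite (xquandle_hom_eval _ (derived_eval_hom dd)).
by congr (term_eval _ t); apply/funext => q; exact: derived_eval_gen.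
Qed.

Lemma derived_universal :
  virtual_derived phi (derived_gen : Q -> derived_xquandle).
Proof.
split=> [|B d dd]; first exact: derived_gen_derivation.
exists (derived_eval d); split=> [|l [l_hom lE]].
  by split=> [|q]; [exact: derived_eval_hom | exact: derived_eval_gen].
(* Uniqueness: [x] is a term in the generators, so [l x] is the same term in the values
   [l (derived_gen q)], which are prescribed. *)
apply/funext => x; rewrite -[x in RHS]reprK -term_eval_gen.
rewrite (xquandle_hom_eval _ l_hom); congr (term_eval _ _).
by apply/funext => q; rewrite /= lE.
Qed.

End DerivedQuandle.

(** * Uniqueness up to isomorphism *)

Lemma xquandle_hom_comp (Q : vquandleType) (A B C : xquandle Q) (f : A -> B)
    (g : B -> C) :
  xquandle_hom f -> xquandle_hom g -> xquandle_hom (g \o f).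
Proof.
move=> [[fM fC] fX] [[gM gC] gX].
by do ![split] => [a b|a|h a] /=; rewrite ?fM ?gM ?gC ?fC ?fX ?gX.
Qed.

(** Both [f] and the identity factor [d] through itself, so the universal property identifies
    them. *)
Lemma virtual_derived_endo (Q Q' : vquandleType) (phi : Q -> Q')
    (A : xquandle Q') (d : Q -> A) (f : A -> A) :
  virtual_derived phi d -> xquandle_hom f -> (forall q, f (d q) = d q) ->
  f = id.
Proof.
move=> [dd univ] f_hom fE; have [l [_ l_unique]] := univ A d dd.
by rewrite -(l_unique f) // -(l_unique id).
Qed.

Theorem theorem5p5 (Q Q' : vquandleType) (phi : Q -> Q')
    (hphi : vquandle_hom phi) :
  (exists (A : xquandle Q') (d : Q -> A), virtual_derived phi d) /\
  (forall (A1 : xquandle Q') (d1 : Q -> A1) (A2 : xquandle Q') (d2 : Q -> A2),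
     virtual_derived phi d1 -> virtual_derived phi d2 ->
     exists f : A1 -> A2, virtual_derived_iso d1 d2 f).
Proof.
split=> [|A1 d1 A2 d2 v1 v2].
  by exists (derived_xquandle phi), (@derived_gen Q Q' phi); exact: derived_universal.
have [[dd1 univ1] [dd2 univ2]] := (v1, v2).
(* Each universal property, applied to the other derivation, gives one comparison map; both
   composites fix the derivations and hence are identities. *)
have [f [[f_hom fE] _]] := univ1 A2 d2 dd2.
have [g [[g_hom gE] _]] := univ2 A1 d1 dd1.
have gfK : g \o f = id.
  apply: (virtual_derived_endo v1); first exact: xquandle_hom_comp.
  by move=> q; rewrite /= fE gE.
have fgK : f \o g = id.
  apply: (virtual_derived_endo v2); first exact: xquandle_hom_comp.
  by move=> q; rewrite /= gE fE.
exists f; split=> //; exists g => a; first exact: (congr1 (@^~ a) gfK).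
exact: (congr1 (@^~ a) fgK).
Qed.
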